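(* For every integer $n \ge 2$, the Cayley index of $Q_8 \times \mathbb{Z}_2^n$ is $8$; that is, $c(Q_8\times\mathbb{Z}_2^n)=8$.
   Context: All groups and graphs are finite; graphs are simple, undirected and without loops. For a group $G$ and a subset $S\subseteq G$ with $S=S^{-1}$ and $1\notin S$, the Cayley graph $\mathrm{Cay}(G,S)$ has vertex set $G$ and edges $\{g,gs\}$ for $g\in G$, $s\in S$. The left-regular representation $L_G$ of $G$ is a subgroup of $\mathrm{Aut}(\mathrm{Cay}(G,S))$. The Cayley index of $\Gamma=\mathrm{Cay}(G,S)$ is $c(\Gamma)=|\mathrm{Aut}(\Gamma):L_G|$, and the Cayley index of the group $G$ is $c(G)=\min_S c(\mathrm{Cay}(G,S))$, the minimum over all subsets $S\subseteq G$ with $S=S^{-1}$ and $1\notin S$. $Q_8=\{\pm1,\pm i,\pm j,\pm k\}$ is the quaternion group of order $8$ and $\mathbb{Z}_2$ is the cyclic group of order $2$. *)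

(* Defs.v *)
From HB Require Import structures.
From mathcomp Require Import all_boot all_fingroup all_algebra all_solvable.

Set Implicit Arguments.
Unset Strict Implicit.
Unset Printing Implicit Defensive.

Import GroupScope.

Section CayleyGraph.
Variable gT : finGroupType.
Implicit Types (S : {set gT}) (g x y : gT).

(* S = S^-1 and 1 \notin S; S^-1 is the pointwise inverse set. *)
Definition connection_set S : bool := (S == S^-1) && (1 \notin S).

(* y \in x *: S means that y = x * s for some s \in S. *)
Definition cayley_graph S : rel gT := fun x y => y \in x *: S.

Lemma cayley_graph_sym S : connection_set S -> symmetric (cayley_graph S).
Proof.
case/andP=> /eqP defS _ x y; rewrite /cayley_graph !mem_lcoset.
by rewrite {2}defS mem_invg invMg invgK.
Qed.

Lemma cayley_graph_irr S : connection_set S -> irreflexive (cayley_graph S).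
Proof.
by case/andP=> _ S'1 x; rewrite /cayley_graph mem_lcoset mulVg (negPf S'1).
Qed.

Definition left_regular : {set {perm gT}} :=
  [set perm (mulgI g) | g : gT].

Lemma left_regular_group_set : group_set left_regular.
Proof.
apply/group_setP; split=> [|_ _ /imsetP[g _ ->] /imsetP[h _ ->]].
  by apply/imsetP; exists 1 => //; apply/permP=> x; rewrite perm1 permE mul1g.
apply/imsetP; exists (h * g) => //; apply/permP=> x.
by rewrite permM !permE mulgA.
Qed.
Canonical left_regular_group := Group left_regular_group_set.

End CayleyGraph.

Section GraphAutomorphisms.
Variables (T : finType) (e : rel T).

Definition graph_aut : {set {perm T}} :=
  [set p : {perm T} | [forall x, forall y, e (p x) (p y) == e x y]].

Lemma graph_autP (p : {perm T}) :
  reflect (forall x y, e (p x) (p y) = e x y) (p \in graph_aut).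
Proof.
rewrite inE; apply: (iffP forallP) => [e_p x y | e_p x].
  exact/eqP/(forallP (e_p x)).
by apply/forallP=> y; apply/eqP.
Qed.

Lemma graph_aut_group_set : group_set graph_aut.
Proof.
apply/group_setP; split=> [|p q /graph_autP e_p /graph_autP e_q].
  by apply/graph_autP=> x y; rewrite !perm1.
by apply/graph_autP=> x y; rewrite !permM e_q e_p.
Qed.
Canonical graph_aut_group := Group graph_aut_group_set.

End GraphAutomorphisms.

Lemma left_regular_sub (gT : finGroupType) (S : {set gT}) :
  left_regular gT \subset graph_aut (cayley_graph S).
Proof.
apply/subsetP=> _ /imsetP[g _ ->]; apply/graph_autP=> x y.
by rewrite /cayley_graph !permE !mem_lcoset invMg mulgA mulgKV.
Qed.

Definition cayley_graph_index (gT : finGroupType) (S : {set gT}) : nat :=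
  #|graph_aut (cayley_graph S) : left_regular gT|.

Lemma connection_set0 (gT : finGroupType) : connection_set (set0 : {set gT}).
Proof.
rewrite /connection_set inE andbT; apply/eqP/setP=> x.
by rewrite mem_invg !inE.
Qed.

(* The default set0 of the arg min satisfies the constraint, by
   connection_set0, so this is a true minimum. *)
Definition cayley_index (gT : finGroupType) : nat :=
  cayley_graph_index
    [arg min_(S < (set0 : {set gT}) | connection_set S) cayley_graph_index S].

Lemma cayley_index_attained (gT : finGroupType) :
  exists2 S : {set gT}, connection_set S
    & cayley_index gT = cayley_graph_index S.
Proof.
rewrite /cayley_index; case: arg_minnP => [|S S_ok _].
  exact: connection_set0.
by exists S.
Qed.

Lemma cayley_index_le (gT : finGroupType) (S : {set gT}) :
  connection_set S -> cayley_index gT <= cayley_graph_index S.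
Proof.
rewrite /cayley_index; case: arg_minnP => [|S0 _ minS0].
  exact: connection_set0.
exact: minS0.
Qed.

(* Main.v *)
Require Import Defs.
From HB Require Import structures.
From mathcomp Require Import all_boot all_fingroup all_algebra all_solvable.

(** The Cayley index of G is the least order of the stabiliser of the vertex 1
    in Aut (Cay(G, S)), because the left translations form a regular subgroup.

    Lower bound.  A permutation p fixing 1 such that p(x)^-1 p(y) is always
    x^-1 y or its inverse is an automorphism of every Cayley graph of G, as S
    is closed under inversion.  Call such a p unavoidable.  In Q_8 the
    unavoidable permutations are the eight maps that multiply each of the
    classes {i,-i}, {j,-j}, {k,-k} by a sign of its own, and a direct factor Z_2
    creates no new ones (card_unavoidable_quat, card_unavoidable_double).
    Hence c(Q_8 x Z_2^n) >= 8 for every n.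

    Upper bound.  Call S rigid when every automorphism fixing 1 sends each x to
    x or x^-1.  Translating x to 1 shows that these automorphisms are then all
    unavoidable, so that one rigid S gives c(G) = 8 (cayley_index_rigid).
    Rigid sets are produced by induction on n >= 2.

    - For n = 2 the explicit set [seed] is rigid because the number of walks of
      length 4 from 1 to x whose three inner vertices are neighbours of 1 is an
      invariant of x, and it takes different values at x and y unless y is x or
      x^-1.  This is a finite computation on the 32 elements.
    - From G to G x Z_2, take the complement of the Cartesian product of
      Cay(G, S) with an edge.  If every two vertices of Cay(G, S) have a
      common neighbour, then the edges in the direction of the new factor are
      exactly those of the product which lie in no triangle, and removing them
      leaves two connected copies of Cay(G, S); so every automorphism fixing 1
      acts in the same way on both copies, and rigidity passes to the product
      (prism_rigid), hence to its complement.  Complementation is there to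
      restore the common neighbours, which the product lacks.

    The induction is run on a copy [quat_pow n] of Q_8 x Z_2^n whose elements
    are tuples of booleans; the Cayley index is an isomorphism invariant
    (cayley_index_iso). *)

Set Implicit Arguments.
Unset Strict Implicit.
Unset Printing Implicit Defensive.

Local Open Scope group_scope.

(** * Vertex stabilisers and unavoidable automorphisms *)

Section Index.
Variable gT : finGroupType.
Implicit Types (S : {set gT}) (p : {perm gT}) (x y g : gT).

Lemma cayley_graphE S x y : cayley_graph S x y = (x^-1 * y \in S).
Proof. by rewrite /cayley_graph mem_lcoset. Qed.

Definition aut_fix1 S : {set {perm gT}} :=
  [set p in graph_aut (cayley_graph S) | p 1 == 1].

Lemma aut_fix1P S p :
  reflect (p 1 = 1 /\ forall x y, ((p x)^-1 * p y \in S) = (x^-1 * y \in S))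
          (p \in aut_fix1 S).
Proof.
rewrite inE; apply: (iffP andP) => [[/graph_autP Ap /eqP p1] | [p1 Ap]].
  by split=> // x y; rewrite -!cayley_graphE.
split; last exact/eqP.
by apply/graph_autP=> x y; rewrite !cayley_graphE.
Qed.

(** Orbit-stabiliser: left translations make the automorphism group
    transitive, and there are as many of them as vertices. *)
Lemma cayley_graph_index_fix1 S : cayley_graph_index S = #|aut_fix1 S|.
Proof.
pose A := graph_aut (cayley_graph S).
have LA := left_regular_sub S.
have cardL : #|left_regular gT| = #|gT|.
  rewrite card_imset // => g h eq_gh.
  by have := congr1 (fun p : {perm gT} => p 1) eq_gh; rewrite !permE !mulg1.
have fix1E : aut_fix1 S = 'C_A[1 | 'P].
  apply/setP=> p; rewrite inE [RHS]in_setI; congr (_ && _).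
  exact/eqP/astab1P.
have orbE : orbit 'P A 1 = [set: gT].
  apply/setP=> g; rewrite inE; apply/orbitP; exists (perm (mulgI g)).
    by apply: (subsetP LA); apply: imset_f.
  by rewrite /= apermE permE mulg1.
have := card_orbit_stab 'P [group of A] 1.
rewrite orbE -fix1E cardsT -(Lagrange LA) cardL => /eqP.
by rewrite eqn_pmul2l => [/eqP|]; last by apply/card_gt0P; exists 1.
Qed.

(** These are the automorphisms fixing 1 that survive every choice of an
    inverse-closed S, since membership in S cannot tell g from g^-1. *)
Definition unavoidable : {set {perm gT}} :=
  [set p : {perm gT} | (p 1 == 1) &&
    [forall x, forall y, (p x)^-1 * p y \in [set x^-1 * y; y^-1 * x]]].

Lemma unavoidableP p :
  reflect (p 1 = 1 /\
           forall x y, (p x)^-1 * p y = x^-1 * y \/ (p x)^-1 * p y = y^-1 * x)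
          (p \in unavoidable).
Proof.
rewrite inE; apply: (iffP andP) => [[/eqP p1 /forallP Up] | [p1 Up]].
  by split=> // x y; apply/set2P; have /forallP := Up x; apply.
split; first exact/eqP.
by apply/forallP=> x; apply/forallP=> y; apply/set2P.
Qed.

Lemma unavoidable_sub S : connection_set S -> unavoidable \subset aut_fix1 S.
Proof.
case/andP=> /eqP defS _; apply/subsetP=> p /unavoidableP[p1 Up].
apply/aut_fix1P; split=> // x y; case: (Up x y) => -> //.
by rewrite [in RHS]defS mem_invg invMg invgK.
Qed.

Definition rigid S := forall p x, p \in aut_fix1 S -> p x = x \/ p x = x^-1.

(** Rigidity only speaks of pairs (1, x); conjugating an automorphism by left
    translations moves an arbitrary pair (x, y) to (1, x^-1 y). *)
Lemma rigid_unavoidable S : rigid S -> aut_fix1 S \subset unavoidable.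
Proof.
move=> Srigid; apply/subsetP=> p /aut_fix1P[p1 Ap].
apply/unavoidableP; split=> // x y.
pose q := perm (mulgI x) * p * perm (mulgI (p x)^-1).
have qE u : q u = (p x)^-1 * p (x * u) by rewrite !permM !permE.
have : q \in aut_fix1 S.
  apply/aut_fix1P; split=> [|u v]; first by rewrite qE mulg1 mulVg.
  by rewrite !qE invMg invgK mulgA mulgK Ap invMg mulgA mulgKV.
by move/(Srigid q (x^-1 * y)); rewrite qE mulKVg invMg invgK.
Qed.

Lemma cayley_index_rigid S :
  connection_set S -> rigid S -> cayley_index gT = #|unavoidable|.
Proof.
move=> okS Srigid; apply/eqP; rewrite eqn_leq; apply/andP; split.
  apply: leq_trans (cayley_index_le okS) _.
  by rewrite cayley_graph_index_fix1 subset_leq_card ?rigid_unavoidable.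
have [S0 okS0 ->] := cayley_index_attained gT.
by rewrite cayley_graph_index_fix1 subset_leq_card ?unavoidable_sub.
Qed.

End Index.

(** * Invariance under isomorphism *)

Lemma cayley_index_le_iso (gT hT : finGroupType) (f : gT -> hT) :
  {morph f : x y / x * y} -> bijective f -> cayley_index hT <= cayley_index gT.
Proof.
move=> fM [f' fK f'K]; have [S okS ->] := cayley_index_attained gT.
have f1 : f 1 = 1 by apply: (mulgI (f 1)); rewrite -fM !mulg1.
have fV x : f x^-1 = (f x)^-1 by apply: (mulgI (f x)); rewrite -fM !mulgV f1.
have f'inj := can_inj f'K; have finj := can_inj fK.
have memf x : (f x \in f @: S) = (x \in S) by rewrite mem_imset.
have okfS : connection_set (f @: S).
  case/andP: okS => /eqP defS S'1; apply/andP; split; last by rewrite -f1 memf.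
  apply/eqP/setP=> y; rewrite -[y]f'K mem_invg -fV !memf.
  by rewrite [in LHS]defS mem_invg.
apply: leq_trans (cayley_index_le okfS) _; rewrite !cayley_graph_index_fix1.
pose conj (p : {perm hT}) : {perm gT} :=
  perm (inj_comp f'inj (inj_comp (@perm_inj _ p) finj)).
have conjE p x : f (conj p x) = p (f x) by rewrite permE /= f'K.
rewrite -(@card_imset _ _ conj) => [|p q eq_pq]; last first.
  by apply/permP=> y; rewrite -[y]f'K -!conjE eq_pq.
apply/subset_leq_card/subsetP=> _ /imsetP[p /aut_fix1P[p1 Ap] ->].
apply/aut_fix1P; split=> [|x y]; first by apply: (can_inj fK); rewrite conjE f1.
by rewrite -!memf !fM !fV !conjE Ap.
Qed.

Lemma cayley_index_iso (gT hT : finGroupType) (f : gT -> hT) :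
  {morph f : x y / x * y} -> bijective f -> cayley_index gT = cayley_index hT.
Proof.
move=> fM f_bij; apply/eqP; rewrite eqn_leq (cayley_index_le_iso fM f_bij) andbT.
case: (f_bij) => f' fK f'K.
apply: (@cayley_index_le_iso _ _ f'); last by exists f.
by move=> x y; apply: (can_inj fK); rewrite fM !f'K.
Qed.

(** * Adding a direct factor of order two *)

(** The group of order two is taken on [bool], with exclusive or, so that
    statements about small groups can be decided by evaluation. *)
HB.instance Definition _ := Finite_isGroup.Build bool addbA addFb addbb.

Section Doubling.
Variable gT : finGroupType.
Implicit Types (S : {set gT}) (p : {perm gT}) (x y g : gT).

Lemma layerwise_inj p : injective (fun u : gT * bool => (p u.1, u.2)).
Proof. by move=> [x a] [y b] [/perm_inj-> ->]. Qed.

Definition layerwise p : {perm gT * bool} := perm (@layerwise_inj p).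

(** The two layers G x {0} and G x {1} are joined by the rungs (x,0)--(x,1); a
    permutation that preserves the rungs and the layers acts on both layers in
    the same way. *)
Lemma layerwise_of_rungs (q : {perm gT * bool}) :
  (forall x a, q (x, a) = q (x, false) * (1, a)) ->
  (forall x, (q (x, false)).2 = false) -> exists p, q = layerwise p.
Proof.
move=> qM q2.
have inj_p : injective (fun x => (q (x, false)).1).
  move=> x y /= eq_q1; suff /perm_inj[] : q (x, false) = q (y, false) by [].
  by rewrite [LHS]surjective_pairing [RHS]surjective_pairing /= eq_q1 !q2.
exists (perm inj_p); apply/permP=> -[x a]; rewrite qM !permE /=.
by rewrite [LHS]surjective_pairing /= mulg1 q2.
Qed.

(** (1,1) is its own inverse, so an unavoidable permutation commutes with
    multiplication by it; the second coordinate of x^-1 y is also unaffected by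
    inversion. *)
Lemma card_unavoidable_double :
  #|unavoidable (gT * bool)%type| = #|unavoidable gT|.
Proof.
have layerwise_perm_inj : injective layerwise.
  move=> p q eq_pq; apply/permP=> x.
  have := congr1 (fun r : {perm _} => (r (x, false)).1) eq_pq.
  by rewrite !permE.
rewrite -(card_imset _ layerwise_perm_inj); apply: eq_card => q.
apply/idP/imsetP=> [/unavoidableP[q1 Uq] | [p /unavoidableP[p1 Up] ->]].
  have qM x a : q (x, a) = q (x, false) * (1, a).
    apply: (mulgI (q (x, false))^-1); rewrite mulKg.
    by case: (Uq (x, false) (x, a)) => ->; congr (_, _); rewrite ?mulVg //;
       case: a.
  have q2 x : (q (x, false)).2 = false.
    by case: (Uq 1 (x, false)); rewrite q1 invg1 mul1g => ->.
  have [p def_q] := layerwise_of_rungs qM q2; exists p => //.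
  have pE x : p x = (q (x, false)).1 by rewrite def_q permE.
  apply/unavoidableP; split=> [|x y]; first by rewrite pE q1.
  rewrite !pE.
  by case: (Uq (x, false) (y, false)) => /(congr1 fst) /=; [left | right].
apply/unavoidableP; split=> [|[x a] [y b]]; first by rewrite permE /= p1.
rewrite !permE /=.
by case: (Up x y) => eq_p; [left | right]; congr (_, _) => //; apply: addbC.
Qed.

End Doubling.

(** * Complementary connection sets *)

Section Complement.
Variable gT : finGroupType.
Implicit Types (S : {set gT}) (p : {perm gT}) (x y g : gT).

(** The connection set of the complementary graph. *)
Definition co_set S : {set gT} := ~: (1 |: S).

Lemma in_co_set S x : (x \in co_set S) = (x != 1) && (x \notin S).
Proof. by rewrite !inE negb_or. Qed.

Lemma co_setK S : 1 \notin S -> co_set (co_set S) = S.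
Proof.
move=> S'1; apply/setP=> x; rewrite !in_co_set negb_and !negbK.
by have [->|] := eqVneq x 1; rewrite ?(negPf S'1).
Qed.

Lemma aut_fix1_co_sub S : aut_fix1 S \subset aut_fix1 (co_set S).
Proof.
apply/subsetP=> p /aut_fix1P[p1 Ap]; apply/aut_fix1P; split=> // x y.
by rewrite !in_co_set Ap -!eq_mulVg1 (inj_eq perm_inj).
Qed.

Lemma connection_co_set S : connection_set S -> connection_set (co_set S).
Proof.
case/andP=> /eqP defS _; apply/andP; split; last by rewrite in_co_set eqxx.
apply/eqP/setP=> x; rewrite mem_invg !in_co_set invg_eq1; congr (_ && ~~ _).
by rewrite [in LHS]defS mem_invg.
Qed.

Lemma rigid_co_set S : 1 \notin S -> rigid S -> rigid (co_set S).
Proof.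
move=> S'1 Srigid p x /(subsetP (aut_fix1_co_sub _)); rewrite co_setK //.
exact: Srigid.
Qed.

End Complement.

(** * The prism over a Cayley graph and its complement *)

(** Any two distinct vertices of Cay(G, S) have a common neighbour. *)
Definition two_step (gT : finGroupType) (S : {set gT}) :=
  forall g, g != 1 -> exists2 s, s \in S & s^-1 * g \in S.

(** No vertex has fewer than two non-neighbours other than itself; in this form
    one of them can be chosen away from any prescribed g. *)
Definition two_nonneighbours (gT : finGroupType) (S : {set gT}) :=
  forall g, exists2 k, k \in co_set S & k != g.

Section Step.
Variables (gT : finGroupType) (S : {set gT}).

(** Cay(G x Z_2, prism) is the Cartesian product of Cay(G, S) with an edge. *)
Definition prism : {set gT * bool} :=
  [set u | if u.2 then u.1 == 1 else u.1 \in S].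

Lemma prism_connection : connection_set S -> connection_set prism.
Proof.
case/andP=> /eqP defS S'1; apply/andP; split; last by rewrite inE.
apply/eqP/setP=> -[x a]; rewrite mem_invg !inE; case: a => /=.
  by rewrite invg_eq1.
by rewrite [in LHS]defS mem_invg.
Qed.

(** A rung lies in no triangle, whereas each edge inside a layer does, because
    its ends have a common neighbour there.  So automorphisms preserve the
    rungs; as the layers are connected once the rungs are removed, those fixing
    1 preserve the layers as well. *)
Lemma prism_rigid : 1 \notin S -> two_step S -> rigid S -> rigid prism.
Proof.
move=> S'1 S2 Srigid q u0 /aut_fix1P[q1 Aq].
have Aq' u t : t \in prism -> (q u)^-1 * q (u * t) \in prism.
  by rewrite Aq mulKg.
(* A direction in which no edge lies in a triangle is that of the rungs. *)
have rungE (e : gT * bool) : e \in prism ->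
    (forall s, s \in prism -> s^-1 * e \notin prism) -> e = (1, true).
  case: e => x [] /[!inE] /=; first by move/eqP->.
  move=> Sx noS; have nt_x : x != 1 by apply: contraNneq S'1 => <-.
  have [s Ss Ssx] := S2 x nt_x.
  by have := noS (s, false); rewrite !inE /= Ss Ssx => /(_ isT).
(* Conversely, rungs lie in no triangle. *)
have rung_no s : s \in prism -> s^-1 * (1, true) \notin prism.
  case: s => s []; rewrite !inE /=; first by move/eqP->; rewrite invg1 mul1g.
  by apply: contraTneq => /eqP; rewrite mulg1 invg_eq1 => /eqP->.
(* Pulling a triangle on q u -- q (u (1,1)) back by q would give one on a
   rung. *)
have qrung u : q (u * (1, true)) = q u * (1, true).
  rewrite -[LHS](mulKVg (q u)); congr (_ * _); apply: rungE.
    by apply: Aq'; rewrite inE /= eqxx.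
  move=> s Xs; have [v def_v] : exists v, q v = q u * s.
    by exists (q^-1 (q u * s)); rewrite permKV.
  have Xv : u^-1 * v \in prism by rewrite -Aq def_v mulKg.
  apply: contra (rung_no _ Xv); rewrite invMg invgK.
  by rewrite mulgA -invMg -def_v Aq mulgA.
(* An edge inside a layer cannot be sent to a rung, as the rung at its end is
   already the image of a rung. *)
have qside u s : s \in S -> (q (u * (s, false))).2 = (q u).2.
  move=> Ss; have := Aq' u (s, false); rewrite inE /= => /(_ Ss).
  set t := _ * _ => Xt; have -> : q (u * (s, false)) = q u * t.
    by rewrite /t mulKVg.
  suff t2 : t.2 = false by rewrite -[LHS]/((q u).2 (+) t.2) t2 addbF.
  case def_t: t Xt => [t1 []] //=; rewrite inE /= => /eqP t1_1.
  have /perm_inj/mulgI [] // : q (u * (s, false)) = q (u * (1, true)).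
  by rewrite qrung -t1_1 -def_t mulKVg.
(* Two steps inside the layer lead from 1 to any other vertex of it. *)
have q2 x : (q (x, false)).2 = false.
  have [->|nt_x] := eqVneq x 1; first by rewrite q1.
  have [s Ss Ssx] := S2 x nt_x.
  have -> : (x, false)
      = (1, false) * (s, false) * (s^-1 * x, false) :> gT * bool.
    by congr (_, _); rewrite mul1g mulKVg.
  by rewrite !qside // q1.
have qM x a : q (x, a) = q (x, false) * (1, a).
  case: a; last by rewrite mulg1.
  by rewrite -qrung; congr (q (_, _)); rewrite mulg1.
have [p def_q] := layerwise_of_rungs qM q2.
have pE x : (q (x, false)).1 = p x by rewrite def_q permE.
have Ap : p \in aut_fix1 S.
  apply/aut_fix1P; split=> [|x y]; first by rewrite -pE q1.
  by have := Aq (x, false) (y, false); rewrite !inE /= !q2 /= !pE.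
rewrite def_q permE /=; case: u0 => x a /=.
by case: (Srigid p x Ap) => ->; [left | right].
Qed.

(** In the complement every vertex of one layer sees all of the other layer
    except the opposite end of its rung.  A common neighbour of 1 and (g,c) is
    found in the layer that does not contain (g,c); when this is the layer of
    1, it has to be a non-neighbour of 1 in Cay(G, S). *)
Lemma prism_co_two_step : two_nonneighbours S -> two_step (co_set prism).
Proof.
move=> nonS [g c] _.
have [k cok k'g] := nonS g; move: cok; rewrite in_co_set => /andP[nt_k S'k].
have nt_kg : k^-1 * g != 1 by rewrite -eq_mulVg1.
have in_co x a : ((x, a) \in co_set prism) = (x != 1) && (a || (x \notin S)).
  rewrite in_co_set inE -[(x, a) == 1]/((x == 1) && (a == false)).
  by case: a; rewrite /= ?andbF ?andbT.
exists (k, ~~ c); first by rewrite in_co nt_k S'k orbT.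
by case: c; rewrite in_co nt_kg.
Qed.

(** Non-neighbours of 1 in the complement are its neighbours in the prism: the
    other end of its rung, and the elements of S. *)
Lemma prism_co_two_nonneighbours :
  1 \notin S -> S != set0 -> two_nonneighbours (co_set prism).
Proof.
move=> S'1 /set0Pn[s Ss] g; rewrite co_setK; last by rewrite inE.
have [-> | g'e] := eqVneq g (1, true); last first.
  by exists (1, true); [rewrite inE /= eqxx | rewrite eq_sym].
by exists (s, false); [rewrite inE | apply/eqP; case].
Qed.

End Step.

(** * A computable copy of the quaternion group *)

(** The triple (s, a, b) stands for z^s i^a j^b, where z = -1. *)
Definition quat : Type := (bool * bool * bool)%type.
HB.instance Definition _ := Finite.on quat.

Definition quat_mul (u v : quat) : quat :=
  let: (s, a, b) := u in let: (t, c, d) := v in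
  (s (+) t (+) (a && c) (+) (b && d) (+) (b && c), a (+) c, b (+) d).
Definition quat_inv (u : quat) : quat :=
  let: (s, a, b) := u in (s (+) (a || b), a, b).

Lemma quat_mulA : associative quat_mul.
Proof. by do 3!case=> [[[] []] []]. Qed.
Lemma quat_mul1 : left_id ((false, false, false) : quat) quat_mul.
Proof. by case=> [[[] []] []]. Qed.
Lemma quat_mulV :
  left_inverse ((false, false, false) : quat) quat_inv quat_mul.
Proof. by case=> [[[] []] []]. Qed.
HB.instance Definition _ :=
  Finite_isGroup.Build quat quat_mulA quat_mul1 quat_mulV.

Fixpoint quat_pow n : finGroupType :=
  if n is m.+1 then (quat_pow m * bool)%type else quat.

(** Multiplication of the sets {i,-i}, {j,-j} and {k,-k}, where k = ij, by
    independent signs, the three components of c. *)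
Definition flip (c : quat) (u : quat) : quat :=
  let: (s, a, b) := u in
  (s (+) (if a then if b then c.2 else c.1.1 else b && c.1.2), a, b).

Lemma flip_inj c : injective (flip c).
Proof. by move: c; do 3!case=> [[[] []] []]. Qed.

(** For u and v in different classes modulo the centre, u^-1 v is not central
    and its inverse is z u^-1 v, so independent signs on the classes are
    harmless; within one class, equal signs cancel. *)
Lemma card_unavoidable_quat : #|unavoidable quat| = 8.
Proof.
pose F c := perm (@flip_inj c).
have F_inj : injective F.
  move=> c d eqF; have eqf u : flip c u = flip d u.
    by have := congr1 (fun p : {perm quat} => p u) eqF; rewrite !permE.
  move: (eqf (false, true, false)) (eqf (false, false, true)).
  move: (eqf (false, true, true)).
  by move: c d {eqF eqf} => [[c1 c2] c3] [[d1 d2] d3] [-> [->] [->]].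
have -> : 8 = #|F @: [set: quat]|.
  by rewrite card_imset // cardsT !card_prod card_bool.
apply: eq_card => p; apply/unavoidableP/imsetP=> [[p1 Up] | [c _ ->]].
  pose d u := (p u).1.1.
  exists (d (false, true, false), d (false, false, true),
          d (false, true, true)) => //.
  (* The two elements of a class differ by the involution z. *)
  have pz s a b : p (s, a, b) = p (false, a, b) * (s, false, false).
    apply: (mulgI (p (false, a, b))^-1); rewrite mulKg.
    by case: (Up (false, a, b) (s, a, b)) => ->; case: s a b => [] [] [].
  have pq a b : p (false, a, b) = (d (false, a, b), a, b).
    have := Up 1 (false, a, b); rewrite p1 invg1 !mul1g mulg1 /d.
    by case=> ->; case: a b => [] [].
  have d1 : d (false, false, false) = false.
    by rewrite /d -[(_, _, _)]/(1 : quat) p1.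
  apply/permP=> -[[s a] b]; rewrite permE pz pq.
  move: d d1 {pq} => d d1.
  by case: a b => [] []; rewrite ?d1; case: s => //; case: (d _).
split=> [|u v]; rewrite !permE //.
move: c u v; do 3!case=> [[[] []] []]; by [left | right].
Qed.

(** * A rigid connection set for Q_8 x Z_2^2 *)

Section Walks.
Variables (gT : finGroupType) (S : {set gT}).

(** The number of walks of length k.+1 from 1 to x whose inner vertices are all
    neighbours of 1; for k = 0 this is adjacency to 1. *)
Fixpoint link_walks k (x : gT) : nat :=
  if k is k'.+1 then \sum_(s in S | s^-1 * x \in S) link_walks k' s
  else x \in S.

Lemma link_walks_aut k (p : {perm gT}) x :
  p \in aut_fix1 S -> link_walks k (p x) = link_walks k x.
Proof.
move=> /aut_fix1P[p1 Ap].
have pS y : (p y \in S) = (y \in S).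
  by have := Ap 1 y; rewrite p1 invg1 !mul1g.
elim: k x => [|k IHk] x /=; first by rewrite pS.
rewrite (reindex_inj (@perm_inj _ p)) /=.
by apply: eq_big => [y | y _]; rewrite ?IHk // pS Ap.
Qed.

(** The same number in a form that evaluates: e enumerates the group and P
    decides membership in S. *)
Fixpoint link_count (P : pred gT) (e : seq gT) k (x : gT) : nat :=
  if k is k'.+1 then
    sumn [seq link_count P e k' s | s <- e & P s && P (s^-1 * x)]
  else P x.

Lemma link_countE P e k x :
  uniq e -> e =i gT -> S =i P -> link_walks k x = link_count P e k x.
Proof.
move=> uniq_e all_e defS; elim: k x => [|k IHk] x /=; first by rewrite defS.
rewrite sumnE big_map big_filter; under eq_bigl do rewrite !defS.
under eq_bigr do rewrite IHk.
by apply: perm_big; apply: uniq_perm; rewrite ?index_enum_uniq // => u;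
   rewrite mem_index_enum all_e.
Qed.

End Walks.

(** With v and w the generators of Z_2^2 given by the last two bits, this is
    {v, w, z} together with the multiples of {v, w, vw} by i and -i, of {vw} by
    j and -j, and of {1, w} by k and -k.  The sizes 6, 2 and 4 of the noncentral
    parts break the symmetry between i, j and k. *)
Definition in_seed (u : quat_pow 2) : bool :=
  let: (s, a, b, x, y) := u : bool * bool * bool * bool * bool in
  if a then if b then ~~ x else x || y
  else if b then x && y else (s + x + y == 1)%N.

Definition seed : {set quat_pow 2} := [set u | in_seed u].

Definition quat_pow2_enum : seq (quat_pow 2) :=
  let bits := [:: false; true] in
  let extend (T : Type) (r : seq T) := [seq (u, x) | u <- r, x <- bits] in
  extend _ (extend _ (extend _ (extend _ bits))).

Lemma mem_quat_pow2_enum u : u \in quat_pow2_enum.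
Proof. by case: u => -[[[[] []] []] []] []. Qed.

Lemma all_quat_pow2P (P : pred (quat_pow 2)) :
  all P quat_pow2_enum -> forall u, P u.
Proof. by move/allP=> Pe u; rewrite Pe ?mem_quat_pow2_enum. Qed.

(** The number of walks of length 4 through the neighbourhood of 1 separates
    the 20 sets {x, x^-1}. *)
Lemma seed_rigid : rigid seed.
Proof.
move=> p x Ap; pose w := link_count in_seed quat_pow2_enum 3.
have wE u : link_walks seed 3 u = w u.
  by apply: link_countE => // v; rewrite ?mem_quat_pow2_enum ?inE.
have := link_walks_aut 3 x Ap; rewrite !wE.
(* Each number is tabulated once before the comparison of all pairs. *)
have sep : all (fun uw => all (fun vw =>
    (uw.2 == vw.2) ==> (uw.1 == vw.1) || (uw.1 == (vw.1)^-1))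
    [seq (u, w u) | u <- quat_pow2_enum]) [seq (u, w u) | u <- quat_pow2_enum].
  by vm_compute.
have memw u : (u, w u) \in [seq (u, w u) | u <- quat_pow2_enum].
  by apply/map_f/mem_quat_pow2_enum.
have := allP (allP sep _ (memw (p x))) _ (memw x).
by move=> /= /implyP/[swap] -> /(_ (eqxx _))/orP[]/eqP; [left | right].
Qed.

Lemma seed_connection : connection_set seed.
Proof.
rewrite /connection_set inE andbT; apply/eqP/setP=> u; rewrite mem_invg !inE.
by apply/eqP; move: u; apply: all_quat_pow2P; vm_compute.
Qed.

Lemma seed_two_step : two_step seed.
Proof.
move=> g; suff /(_ g)/implyP sep : forall g, (g != 1) ==>
    has (fun s => in_seed s && in_seed (s^-1 * g)) quat_pow2_enum.
  by move=> /sep/hasP[s _ /andP[Ss Ssg]]; exists s; rewrite inE.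
by apply: all_quat_pow2P; vm_compute.
Qed.

Lemma seed_two_nonneighbours : two_nonneighbours seed.
Proof.
move=> g; pose a : quat_pow 2 := (false, false, false, true, true).
pose b : quat_pow 2 := (true, false, false, true, true).
have [-> | g'a] := eqVneq g a.
  by exists b; rewrite ?in_co_set ?inE.
by exists a; rewrite 1?eq_sym // in_co_set inE.
Qed.

(** * The Cayley index of Q_8 x Z_2^n *)

Lemma rigid_family n :
  exists S : {set quat_pow n.+2},
    [/\ connection_set S, rigid S, two_step S & two_nonneighbours S].
Proof.
elim: n => [|n [S [okS Srigid S2 nonS]]].
  exists seed; split; [exact: seed_connection | exact: seed_rigid |
                       exact: seed_two_step | exact: seed_two_nonneighbours].
have S'1 : 1 \notin S by case/andP: okS.
have prism'1 : 1 \notin prism S by case/andP: (prism_connection okS).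
have S_neq0 : S != set0.
  have [g + _] := nonS 1; rewrite in_co_set => /andP[/S2[s Ss _] _].
  by apply/set0Pn; exists s.
exists (co_set (prism S)); split.
- exact/connection_co_set/prism_connection.
- exact/rigid_co_set/prism_rigid.
- exact: prism_co_two_step.
- exact: prism_co_two_nonneighbours.
Qed.

Lemma cayley_index_quat_pow n : cayley_index (quat_pow n.+2) = 8.
Proof.
have [S [okS Srigid _ _]] := rigid_family n.
rewrite (cayley_index_rigid okS Srigid).
elim: n.+2 => [|m IHm]; first exact: card_unavoidable_quat.
by rewrite [LHS]card_unavoidable_double.
Qed.

(** i and j satisfy the defining relations of Q_8 and generate, so the copy is
    a quotient of Q_8 of the same order. *)
Lemma quat_iso :
  exists2 f : quat -> 'Q_8, {morph f : u v / u * v} & bijective f.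
Proof.
have oQ : #|[set: 'Q_8]| = 8 by exact: (@card_quaternion 3).
have o_quat : #|{: quat}| = 8 by rewrite !card_prod card_bool.
have : [set: quat] \isog [set: 'Q_8].
  rewrite isogEcard oQ cardsT o_quat leqnn andbT (@Grp_quaternion 3) //.
  pose i : quat := (false, true, false); pose j : quat := (false, false, true).
  apply/existsP; exists (i, j); rewrite /= !xpair_eqE /=.
  apply/andP; split; last by [].
  rewrite eqEsubset subsetT; apply/subsetP=> -[[s a] b] _.
  have -> : (s, a, b) = i ^+ (s.*2) * i ^+ a * j ^+ b :> quat.
    by case: s a b => [] [] [].
  by rewrite !groupM ?groupX // mem_gen // inE cycle_id ?orbT.
case/isogP=> f f_inj f_im; exists f => [u v|]; first by rewrite morphM ?inE.
apply: inj_card_bij; last by rewrite o_quat -cardsT oQ.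
by move=> u v; apply: (injmP f_inj); rewrite inE.
Qed.

Lemma quat_pow_iso n :
  exists2 f : quat_pow n -> 'Q_8 * 'rV['Z_2]_n,
    {morph f : u v / u * v} & bijective f.
Proof.
elim: n => [|n [f fM [f' fK f'K]]].
  have [f fM [f' fK f'K]] := quat_iso; exists (fun u => (f u, 0%R)).
    by move=> u v; congr (_, _); rewrite ?fM //; apply/rowP=> -[].
  exists (fun x => f' x.1) => [u | [q v]] /=; rewrite ?fK // f'K; congr (_, _).
  by apply/rowP=> -[].
pose bit (b : bool) : 'rV['Z_2]_1 := const_mx (b%:R)%R.
have bitD b c : bit (b * c) = (bit b + bit c)%R.
  by apply/rowP=> i; rewrite !mxE; apply/eqP; case: b c => [] [].
exists (fun u => ((f u.1).1, row_mx (bit u.2) (f u.1).2 : 'rV_(1 + n))).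
  move=> [u b] [v c]; congr (_, _); rewrite /= fM //.
  rewrite -[RHS]/(row_mx (bit b) (f u).2 + row_mx (bit c) (f v).2)%R.
  by rewrite add_row_mx -bitD.
exists (fun x => let w : 'rV_(1 + n) := x.2 in
                 (f' (x.1, rsubmx w), lsubmx w ord0 ord0 != 0%R)).
  move=> [u b] /=; rewrite row_mxKr row_mxKl -surjective_pairing fK.
  congr (_, _).
  by rewrite mxE; case: b.
move=> [q w] /=; rewrite f'K; congr (_, _); rewrite /= -[RHS]hsubmxK.
congr row_mx; apply/rowP=> i; rewrite mxE (ord1 i).
by apply/eqP; case: (lsubmx _ _ _) => -[|[|m]].
Qed.

Theorem proposition4p7 (n : nat) (hn : 2 <= n) :
  cayley_index ('Q_8 * 'rV['Z_2]_n)%type = 8.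
Proof.
have [f fM f_bij] := quat_pow_iso n.
rewrite -(cayley_index_iso fM f_bij).
by case: n hn {f fM f_bij} => [|[|n]] // _; apply: cayley_index_quat_pow.
Qed.
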